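(* Let $G$ be a finite group, $\omega$ a normalized $3$-cocycle on $G$ with values in $\Bbbk^\times$, $L$ a subgroup of $G$ such that the class of $\omega|_{L^{\times 3}}$ is trivial, and $\psi\in C^2(L,\Bbbk^\times)$ a normalized $2$-cochain with $d\psi=\omega|_{L^{\times 3}}$. Then the twisted group algebra $A(L,\psi)$ admits the structure of a Frobenius algebra in $\mathsf{Vec}_G^\omega$. Moreover, it is connected and special.
   Context: $\Bbbk$ is an algebraically closed field of characteristic $0$. The category $\mathsf{Vec}_G^\omega$: the fusion category of finite-dimensional $G$-graded $\Bbbk$-vector spaces, with grading-preserving linear maps. Its simple objects are $\delta_g$ ($g\in G$), one-dimensional in degree $g$; we also write $\delta_g$ for a fixed basis vector, and $\delta_g\otimes\delta_{g'}$ is identified with $\delta_{gg'}$ as an object. $(V\otimes W)_x=\bigoplus_{yz=x}V_y\otimes W_z$; the associativity constraint is $\alpha_{\delta_g,\delta_{g'},\delta_{g''}}=\omega^{-1}(g,g',g'')\,\mathrm{id}:(\delta_g\otimes\delta_{g'})\otimes\delta_{g''}\to\delta_g\otimes(\delta_{g'}\otimes\delta_{g''})$; the unit is $\mathbf 1=\delta_e$, with $l_{\delta_g}=\omega^{-1}(e,e,g)\,\mathrm{id}$, $r_{\delta_g}=\omega(g,e,e)\,\mathrm{id}$. The cocycle condition is $\omega(g_1g_2,g_3,g_4)\omega(g_1,g_2,g_3g_4)=\omega(g_1,g_2,g_3)\omega(g_1,g_2g_3,g_4)\omega(g_2,g_3,g_4)$. The condition $d\psi=\omega|_{L^{\times3}}$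 means $\psi(f_1,f_2f_3)\psi(f_2,f_3)=\omega(f_1,f_2,f_3)\psi(f_1f_2,f_3)\psi(f_1,f_2)$ for $f_i\in L$. Twisted group algebra: $A(L,\psi)=\bigoplus_{g\in L}\delta_g$ with multiplication $\delta_g\otimes\delta_{g'}\mapsto\psi(g,g')\delta_{gg'}$. In a monoidal category $(\mathcal C,\otimes,\mathbf 1,\alpha,l,r)$: an algebra is $(A,m,u)$ with $m:A\otimes A\to A$, $u:\mathbf 1\to A$ associative and unital; a coalgebra is $(A,\Delta,\varepsilon)$, coassociative and counital; a Frobenius algebra is $(A,m,u,\Delta,\varepsilon)$, both an algebra and a coalgebra, with $(m\otimes\mathrm{id})\alpha^{-1}_{A,A,A}(\mathrm{id}\otimes\Delta)=\Delta m=(\mathrm{id}\otimes m)\alpha_{A,A,A}(\Delta\otimes\mathrm{id})$. It is special if $m\Delta=\mathrm{id}_A$ and $\varepsilon u=\varphi\,\mathrm{id}_{\mathbf 1}$ for some nonzero $\varphi\in\Bbbk$. An algebra $A$ is connected if $\dim_\Bbbk\mathrm{Hom}(\mathbf 1,A)=1$. *)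

(* Defs.v *)
From HB Require Import structures.
From mathcomp Require Import all_boot all_order all_algebra all_fingroup.

Set Implicit Arguments.
Unset Strict Implicit.
Unset Printing Implicit Defensive.

Import GRing.Theory.
Local Open Scope ring_scope.

Reserved Notation "g \oc f" (at level 50, left associativity).
Reserved Notation "f \oxm g" (at level 40, left associativity).
Reserved Notation "A \ox B" (at level 40, left associativity).

(* k-linear monoidal categories whose Hom spaces are finite-dimensional.      *)
(* [mcomp g f] is "g after f".                                                *)
Record monCat (k : fieldType) := MonCat {
  mobj :> Type;
  mhom : mobj -> mobj -> vectType k;
  mid : forall A, mhom A A;
  mcomp : forall A B C, mhom B C -> mhom A B -> mhom A C;
  mtens : mobj -> mobj -> mobj;
  mtensm : forall A B C D, mhom A C -> mhom B D -> mhom (mtens A B) (mtens C D);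
  mone : mobj;
  massoc : forall A B C, mhom (mtens (mtens A B) C) (mtens A (mtens B C));
  massocV : forall A B C, mhom (mtens A (mtens B C)) (mtens (mtens A B) C);
  mlunit : forall A, mhom (mtens mone A) A;
  mlunitV : forall A, mhom A (mtens mone A);
  mrunit : forall A, mhom (mtens A mone) A;
  mrunitV : forall A, mhom A (mtens A mone);

  mcomp1l : forall A B (f : mhom A B), mcomp (mid B) f = f;
  mcomp1r : forall A B (f : mhom A B), mcomp f (mid A) = f;
  mcompA : forall A B C D (h : mhom C D) (g : mhom B C) (f : mhom A B),
        mcomp h (mcomp g f) = mcomp (mcomp h g) f;
  mcompDl : forall A B C (a : k) (g g' : mhom B C) (f : mhom A B),
        mcomp (a *: g + g') f = a *: mcomp g f + mcomp g' f;
  mcompDr : forall A B C (a : k) (g : mhom B C) (f f' : mhom A B),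
        mcomp g (a *: f + f') = a *: mcomp g f + mcomp g f';

  mtensm1 : forall A B, mtensm (mid A) (mid B) = mid (mtens A B);
  mtensm_comp : forall A B C A' B' C'
        (g : mhom B C) (f : mhom A B) (g' : mhom B' C') (f' : mhom A' B'),
        mtensm (mcomp g f) (mcomp g' f') = mcomp (mtensm g g') (mtensm f f');
  mtensmDl : forall A B C D (a : k) (f f' : mhom A C) (g : mhom B D),
        mtensm (a *: f + f') g = a *: mtensm f g + mtensm f' g;
  mtensmDr : forall A B C D (a : k) (f : mhom A C) (g g' : mhom B D),
        mtensm f (a *: g + g') = a *: mtensm f g + mtensm f g';

  massocK : forall A B C, mcomp (massocV A B C) (massoc A B C) = mid _;
  massocVK : forall A B C, mcomp (massoc A B C) (massocV A B C) = mid _;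
  massoc_nat : forall A B C A' B' C' (f : mhom A A') (g : mhom B B') (h : mhom C C'),
        mcomp (massoc A' B' C') (mtensm (mtensm f g) h) =
        mcomp (mtensm f (mtensm g h)) (massoc A B C);

  mlunitK : forall A, mcomp (mlunitV A) (mlunit A) = mid _;
  mlunitVK : forall A, mcomp (mlunit A) (mlunitV A) = mid _;
  mlunit_nat : forall A B (f : mhom A B),
        mcomp (mlunit B) (mtensm (mid mone) f) = mcomp f (mlunit A);
  mrunitK : forall A, mcomp (mrunitV A) (mrunit A) = mid _;
  mrunitVK : forall A, mcomp (mrunit A) (mrunitV A) = mid _;
  mrunit_nat : forall A B (f : mhom A B),
        mcomp (mrunit B) (mtensm f (mid mone)) = mcomp f (mrunit A);

  mpentagon : forall A B C D,
        mcomp (massoc A B (mtens C D)) (massoc (mtens A B) C D) =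
        mcomp (mtensm (mid A) (massoc B C D))
          (mcomp (massoc A (mtens B C) D) (mtensm (massoc A B C) (mid D)));
  mtriangle : forall A B,
        mcomp (mtensm (mid A) (mlunit B)) (massoc A mone B) =
        mtensm (mrunit A) (mid B)
}.

Arguments mid {k m A}.
Arguments mone {k m}.
Arguments massoc {k m} A B C.
Arguments massocV {k m} A B C.

Notation "g \oc f" := (mcomp g f).
Notation "f \oxm g" := (mtensm f g).
Notation "A \ox B" := (mtens A B).

Section Frobenius.
Variables (k : fieldType) (C : monCat k) (A : C).
Variables (m : mhom (A \ox A) A) (u : mhom mone A).
Variables (D : mhom A (A \ox A)) (e : mhom A mone).

Definition is_algebra : Prop :=
  [/\ m \oc (m \oxm mid) = m \oc (mid \oxm m) \oc massoc A A A,
      m \oc (u \oxm mid) = mlunit A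
    & m \oc (mid \oxm u) = mrunit A].

Definition is_coalgebra : Prop :=
  [/\ massoc A A A \oc (D \oxm mid) \oc D = (mid \oxm D) \oc D,
      mlunit A \oc (e \oxm mid) \oc D = mid
    & mrunit A \oc (mid \oxm e) \oc D = mid].

Definition is_frobenius : Prop :=
  [/\ is_algebra, is_coalgebra,
      (m \oxm mid) \oc massocV A A A \oc (mid \oxm D) = D \oc m
    & (mid \oxm m) \oc massoc A A A \oc (D \oxm mid) = D \oc m].

Definition is_special : Prop :=
  m \oc D = mid /\ exists2 phi : k, phi != 0 & e \oc u = phi *: mid.

Definition is_connected : Prop := \dim {: mhom (@mone k C) A} = 1%N.

End Frobenius.

(* The tensor product of V and W is realised by matrices of coordinates in    *)
(* the library's bases of V and W; [tlift_pt] and [tensP] below state that    *)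
(* [pt] is a universal bilinear map.                                          *)
Definition tens (k : fieldType) (V W : vectType k) : vectType k :=
  'M[k]_(\dim {:V}, \dim {:W}).

Section Tensor.
Variable k : fieldType.
Implicit Types V W U : vectType k.

Definition pt V W (v : V) (w : W) : tens V W :=
  \matrix_(i, j) (coord (vbasis {:V}) i v * coord (vbasis {:W}) j w).

Definition tlift V W U (b : V -> W -> U) (X : tens V W) : U :=
  \sum_i \sum_j X i j *: b (vbasis {:V})`_i (vbasis {:W})`_j.

Definition bilin V W U (b : V -> W -> U) : Prop :=
  (forall w, linear (b^~ w)) /\ (forall v, linear (b v)).

Lemma tlift_linear V W U (b : V -> W -> U) : linear (tlift b).
Proof.
move=> a X Y; rewrite /tlift scaler_sumr -big_split /=; apply: eq_bigr => i _.
rewrite scaler_sumr -big_split /=; apply: eq_bigr => j _.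
by rewrite !mxE scalerDl scalerA.
Qed.

HB.instance Definition _ V W U (b : V -> W -> U) :=
  GRing.isLinear.Build k (tens V W) U _ (tlift b) (tlift_linear b).

Lemma pt_bilin V W : bilin (@pt V W).
Proof.
split=> [w|v] a x y; apply/matrixP=> i j; rewrite !mxE linearP /=.
  by rewrite mulrDl mulrA.
by rewrite mulrDr mulrCA.
Qed.

Lemma linear_sum_fun V U (f : V -> U) : linear f ->
  forall (I : Type) (r : seq I) (P : pred I) (c : I -> k) (v : I -> V),
  f (\sum_(i <- r | P i) c i *: v i) = \sum_(i <- r | P i) c i *: f (v i).
Proof.
move=> lf I r P c v.
have f0 : f 0 = 0.
  by have := lf (-1) 0 0; rewrite scaler0 addr0 scaleN1r addNr.
elim: r => [|i r IH]; first by rewrite !big_nil.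
by rewrite !big_cons; case: ifP => // _; rewrite lf IH.
Qed.

Lemma tlift_pt V W U (b : V -> W -> U) : bilin b ->
  forall v w, tlift b (pt v w) = b v w.
Proof.
case=> bl br v w; rewrite /tlift.
rewrite {2}(coord_vbasis (memvf v)) (linear_sum_fun (bl w)).
apply: eq_bigr => i _.
rewrite {2}(coord_vbasis (memvf w)) (linear_sum_fun (br _)) scaler_sumr.
by apply: eq_bigr => j _; rewrite mxE scalerA.
Qed.

Lemma tensP V W U (f f' : 'Hom(tens V W, U)) :
  (forall v w, f (pt v w) = f' (pt v w)) -> f = f'.
Proof.
move=> ff'; apply/lfunP => X.
suff -> : X = \sum_i \sum_j X i j *: pt (vbasis {:V})`_i (vbasis {:W})`_j.
  rewrite !linear_sum; apply: eq_bigr => i _.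
  by rewrite !linear_sum; apply: eq_bigr => j _; rewrite !linearZ /= ff'.
apply/matrixP => i j; rewrite summxE (bigD1 i) //= summxE (bigD1 j) //=.
rewrite !mxE !coord_free ?(basis_free (vbasisP _)) // !eqxx !mulr1.
rewrite !big1 ?addr0 // => [i' ni|j' nj].
  rewrite summxE big1 // => j' _; rewrite !mxE.
  by rewrite (coord_free _ _ (basis_free (vbasisP _))) (negPf ni) mul0r mulr0.
by rewrite !mxE (coord_free j' _ (basis_free (vbasisP _))) (negPf nj) !mulr0.
Qed.

Lemma lin_hom V W (f : 'Hom(V, W)) : linear f.
Proof. exact: linearP. Qed.

Lemma lin_id V : linear (fun v : V => v).
Proof. by []. Qed.

Lemma lin_sum V W (I : Type) (r : seq I) (P : pred I) (F : I -> V -> W) :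
  (forall i, linear (F i)) -> linear (fun v => \sum_(i <- r | P i) F i v).
Proof.
move=> lF a x y; rewrite scaler_sumr -big_split; apply: eq_bigr => i _.
exact: lF.
Qed.

Lemma lin_scale V W (c : k) (f : V -> W) :
  linear f -> linear (fun v => c *: f v).
Proof. by move=> lf a x y; rewrite lf scalerDr !scalerA mulrC. Qed.

Lemma lin_comp V W U (f : W -> U) (g : V -> W) :
  linear f -> linear g -> linear (fun v => f (g v)).
Proof. by move=> lf lg a x y; rewrite lg lf. Qed.

Lemma lin_ptl V W U (f : V -> W) (w : U) :
  linear f -> linear (fun v => pt (f v) w).
Proof. by move=> lf a x y; rewrite lf; apply: (pt_bilin W U).1. Qed.

Lemma lin_ptr V W U (f : V -> W) (w : U) :
  linear f -> linear (fun v => pt w (f v)).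
Proof. by move=> lf a x y; rewrite lf; apply: (pt_bilin U W).2. Qed.

Lemma lin_tlift V W U (T : vectType k) (b : T -> V -> W -> U) X :
  (forall v w, linear (fun t => b t v w)) -> linear (fun t => tlift (b t) X).
Proof.
move=> lb; rewrite /tlift; apply: lin_sum => i; apply: lin_sum => j.
exact: lin_scale.
Qed.

Definition tlin V W U (b : V -> W -> U) : 'Hom(tens V W, U) := linfun (tlift b).

Lemma tlinE V W U (b : V -> W -> U) v w : bilin b -> tlin b (pt v w) = b v w.
Proof. by move=> bb; rewrite lfunE /= tlift_pt. Qed.

Definition tmap V W V' W' (f : 'Hom(V, V')) (g : 'Hom(W, W')) :
  'Hom(tens V W, tens V' W') := tlin (fun v w => pt (f v) (g w)).

Lemma tmapE V W V' W' (f : 'Hom(V, V')) (g : 'Hom(W, W')) v w :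
  tmap f g (pt v w) = pt (f v) (g w).
Proof.
rewrite tlinE //; split=> [w'|v']; last exact/lin_ptr/lin_hom.
exact/lin_ptl/lin_hom.
Qed.

Definition ptl V W (v : V) : 'Hom(W, tens V W) := linfun (@pt V W v).
HB.instance Definition _ V W (v : V) :=
  GRing.isLinear.Build k W (tens V W) _ (pt v) ((pt_bilin V W).2 v).

Definition ptr_fun V W (w : W) (v : V) := pt v w.
HB.instance Definition _ V W (w : W) :=
  GRing.isLinear.Build k V (tens V W) _ (@ptr_fun V W w) ((pt_bilin V W).1 w).
Definition ptr V W (w : W) : 'Hom(V, tens V W) := linfun (ptr_fun w).

Lemma ptlE V W (v : V) (w : W) : ptl W v w = pt v w.
Proof. by rewrite lfunE. Qed.

Lemma ptrE V W (v : V) (w : W) : ptr V w v = pt v w.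
Proof. by rewrite lfunE. Qed.

Lemma pt0l V W (w : W) : pt (0 : V) w = 0.
Proof. by rewrite -ptrE linear0. Qed.

Lemma pt0r V W (v : V) : pt v (0 : W) = 0.
Proof. by rewrite -ptlE linear0. Qed.

Lemma ptZl V W a (v : V) (w : W) : pt (a *: v) w = a *: pt v w.
Proof. by rewrite -!ptrE linearZ. Qed.

Lemma ptZr V W a (v : V) (w : W) : pt v (a *: w) = a *: pt v w.
Proof. by rewrite -!ptlE linearZ. Qed.

Definition tensv V W (X : {vspace V}) (Y : {vspace W}) : {vspace tens V W} :=
  <<[seq pt x y | x <- vbasis X, y <- vbasis Y]>>%VS.

Lemma memv_tensv V W (X : {vspace V}) (Y : {vspace W}) x y :
  x \in X -> y \in Y -> pt x y \in tensv X Y.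
Proof.
move=> Xx Yy; rewrite (coord_vbasis Xx) -ptrE linear_sum /= rpred_sum // => i _.
rewrite ptrE ptZl rpredZ // (coord_vbasis Yy) -ptlE linear_sum /= rpred_sum //.
move=> j _; rewrite ptlE ptZr rpredZ //; apply/memv_span/allpairs_f.
  by apply: mem_nth; rewrite size_tuple.
by apply: mem_nth; rewrite size_tuple.
Qed.

Lemma tensv_sub V W (X : {vspace V}) (Y : {vspace W}) (Z : {vspace tens V W}) :
  (forall x y, x \in X -> y \in Y -> pt x y \in Z) -> (tensv X Y <= Z)%VS.
Proof.
move=> XYZ; apply/span_subvP => _ /allpairsP[[x y] [/= xX yY ->]].
by apply: XYZ; apply: vbasis_mem.
Qed.

End Tensor.

Section Graded.
Variables (k : fieldType) (gT : finGroupType).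

Definition is_grading (V : vectType k) (Vg : gT -> {vspace V}) : Prop :=
  directv (\sum_g Vg g) /\ (\sum_g Vg g)%VS = fullv.

Record grVect := GrVect {
  gvs :> vectType k;
  gcomp : gT -> {vspace gvs};
  gcompP : is_grading gcomp
}.

Lemma gr_direct (V : grVect) : directv (\sum_g gcomp V g).
Proof. by case: (gcompP V). Qed.

Lemma gr_full (V : grVect) : (\sum_g gcomp V g)%VS = fullv.
Proof. by case: (gcompP V). Qed.

Lemma gr_of_proj (V : vectType k) (Vg : gT -> {vspace V}) (P : gT -> 'End(V)) :
    (forall g v, P g v \in Vg g) -> (forall v, \sum_g P g v = v) ->
    (forall g h, g != h -> {in Vg h, forall v, P g v = 0}) ->
  is_grading Vg.
Proof.
move=> PV P1 P0; split; last first.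
  apply/eqP; rewrite eqEsubv subvf; apply/subvP => v _.
  by rewrite -[v]P1; apply: memv_sumr.
apply/directv_sum_independent => us usV us0 g _.
have := congr1 (P g) us0; rewrite linear0 linear_sum (bigD1 g) //= big1.
  rewrite addr0 => Pg; rewrite -[us g]P1 (bigD1 g) //= Pg add0r big1 // => h ng.
  exact: P0 ng _ (usV g isT).
move=> h ng; have gh : g != h by rewrite eq_sym.
exact: P0 gh _ (usV h isT).
Qed.

Definition gproj (V : grVect) (g : gT) : 'End(V) :=
  sumv_pi (\sum_g gcomp V g)%VS g.

Lemma gproj_in (V : grVect) g v : gproj V g v \in gcomp V g.
Proof. exact: memv_sum_pi. Qed.

Lemma gproj_sum (V : grVect) v : \sum_g gproj V g v = v.
Proof. by apply: sumv_pi_sum; rewrite gr_full memvf. Qed.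

Lemma gprojE (V : grVect) g h v :
  v \in gcomp V h -> gproj V g v = if g == h then v else 0.
Proof.
move=> Vv; pose w g := if g == h then v else 0.
have := directv_sum_unique (gr_direct V).
move=> /(_ (fun g => gproj V g v) w) H.
have wV i : w i \in gcomp V i.
  by rewrite /w; case: eqP => [->|] //; rewrite rpred0.
have /esym := H (fun i _ => @gproj_in V i v) (fun i _ => wV i).
rewrite gproj_sum (bigD1 h) //= /w eqxx big1 ?addr0 ?eqxx; last first.
  by move=> i /negPf->.
by move/forallP/(_ g)/eqP.
Qed.

Lemma gr_ext (V : grVect) (U : vectType k) (f f' : V -> U) :
    linear f -> linear f' ->
    (forall g v, v \in gcomp V g -> f v = f' v) ->
  forall v, f v = f' v.
Proof.
move=> lf lf' ff' v; rewrite -[v]gproj_sum.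
under eq_bigr do rewrite -[gproj _ _ _]scale1r.
rewrite !linear_sum_fun //; apply: eq_bigr => g _.
by rewrite (ff' g) ?gproj_in.
Qed.

Lemma tens_ext (V W : grVect) (U : vectType k) (f f' : tens V W -> U) :
    linear f -> linear f' ->
    (forall g h v w, v \in gcomp V g -> w \in gcomp W h ->
       f (pt v w) = f' (pt v w)) ->
  forall X, f X = f' X.
Proof.
move=> lf lf' ff' X.
pose L := GRing.isLinear.Build k _ U _ f lf.
pose L' := GRing.isLinear.Build k _ U _ f' lf'.
pose F : {linear tens V W -> U} := HB.pack f L.
pose F' : {linear tens V W -> U} := HB.pack f' L'.
suff /lfunP/(_ X) : linfun F = linfun F' by rewrite !lfunE.
apply: tensP => v w; rewrite !lfunE /=.
apply: (gr_ext (f := fun v => f (pt v w)) (f' := fun v => f' (pt v w))).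
- exact/(lin_comp lf)/lin_ptl/lin_id.
- exact/(lin_comp lf')/lin_ptl/lin_id.
move=> g {}v Vv.
apply: (gr_ext (f := fun w => f (pt v w)) (f' := fun w => f' (pt v w))).
- exact/(lin_comp lf)/lin_ptr/lin_id.
- exact/(lin_comp lf')/lin_ptr/lin_id.
by move=> h {}w Ww; apply: ff' Vv Ww.
Qed.

Section TensorObject.
Variables V W : grVect.

Definition tens_comp (x : gT) : {vspace tens V W} :=
  (\sum_(p : gT * gT | (p.1 * p.2)%g == x) tensv (gcomp V p.1) (gcomp W p.2))%VS.

Lemma memv_pt g h v w :
  v \in gcomp V g -> w \in gcomp W h -> pt v w \in tens_comp (g * h)%g.
Proof.
move=> Vv Ww; have/subvP : (tensv (gcomp V g) (gcomp W h) <= tens_comp (g * h)%g)%VS.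
  exact: (sumv_sup (g, h)).
by apply; apply: memv_tensv.
Qed.

Let P x : 'End(tens V W) :=
  \sum_(p : gT * gT | (p.1 * p.2)%g == x) tmap (gproj V p.1) (gproj W p.2).

Let P_pt x g h v w : v \in gcomp V g -> w \in gcomp W h ->
  P x (pt v w) = if (g * h == x)%g then pt v w else 0.
Proof.
move=> Vv Ww; rewrite /P sum_lfunE; case: eqP => [<-|gh].
  rewrite (bigD1 (g, h)) //= tmapE (gprojE _ Vv) (gprojE _ Ww) !eqxx.
  rewrite big1 ?addr0 // => -[g' h'] /= /andP[_]; rewrite xpair_eqE negb_and.
  rewrite tmapE (gprojE _ Vv) (gprojE _ Ww).
  by case/orP=> /negPf->; rewrite ?pt0l ?pt0r.
rewrite big1 // => -[g' h'] /= /eqP gh'; rewrite tmapE (gprojE _ Vv) (gprojE _ Ww).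
case: eqP => [eg|]; rewrite ?pt0l //; case: eqP => [eh|]; rewrite ?pt0r //.
by case: gh; rewrite -eg -eh.
Qed.

Lemma tens_gr : is_grading tens_comp.
Proof.
apply: (@gr_of_proj (tens V W) tens_comp P) => [x X|X|x y xy X].
- have: (limg (P x) <= tens_comp x)%VS.
    apply/subvP => _ /memv_imgP[Y _ ->]; rewrite /P sum_lfunE.
    apply: rpred_sum => -[g h] /= /eqP <-.
    rewrite -[Y]/(_ Y).
    pose Q := projv (tens_comp (g * h)%g).
    suff -> : tmap (gproj V g) (gproj W h) = (Q \o tmap (gproj V g) (gproj W h))%VF.
      by rewrite comp_lfunE memv_proj.
    apply: tensP => v w; rewrite comp_lfunE tmapE projv_id //.
    by apply: memv_pt; apply: gproj_in.
  by move/subvP; apply; rewrite memv_img ?memvf.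
- apply: (tens_ext (f := fun X => \sum_x P x X) (f' := id)) => //.
    by apply: lin_sum => x; apply: lin_hom.
  move=> g h v w Vv Ww; rewrite (bigD1 (g * h)%g) //= (P_pt _ Vv Ww) eqxx.
  rewrite big1 ?addr0 // => x; rewrite (P_pt _ Vv Ww) eq_sym.
  by move/negPf->.
- have /subvP sub : (tens_comp y <= lker (P x))%VS.
    apply/subv_sumP => -[g h] /= /eqP gh; apply: tensv_sub => v w Vv Ww.
    by rewrite memv_ker (P_pt _ Vv Ww) gh [y == x]eq_sym (negPf xy).
  by move/sub; rewrite memv_ker => /eqP.
Qed.

Definition gtens : grVect := GrVect tens_gr.

End TensorObject.

Section SimpleObject.
Variable g : gT.

Definition simple_comp (x : gT) : {vspace k^o} := if x == g then fullv else 0%VS.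

Lemma simple_gr : is_grading simple_comp.
Proof.
apply: (@gr_of_proj k^o simple_comp (fun x => if x == g then \1%VF else 0)).
- by move=> x v; rewrite /simple_comp; case: eqP; rewrite ?memvf // zero_lfunE rpred0.
- move=> v; rewrite (bigD1 g) //= eqxx id_lfunE big1 ?addr0 // => x /negPf->.
  by rewrite zero_lfunE.
- move=> x y xy v; rewrite /simple_comp; case: (x =P g) => [xg|]; last first.
    by rewrite zero_lfunE.
  by rewrite id_lfunE -xg eq_sym (negPf xy) memv0 => /eqP.
Qed.

Definition gsimple : grVect := GrVect simple_gr.

End SimpleObject.

Definition gone : grVect := gsimple 1%g.

(* \bigoplus_(i : I) delta_(deg i) *)
Section SumSimple.
Variables (I : finType) (deg : I -> gT).

Definition dl (i : I) : {ffun I -> k^o} := [ffun j => (j == i)%:R].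

Definition sums_comp (x : gT) : {vspace {ffun I -> k^o}} :=
  (\sum_(i | deg i == x) <[dl i]>)%VS.

Lemma ffun_dl (a : {ffun I -> k^o}) : a = \sum_i a i *: dl i.
Proof.
apply/ffunP => j; rewrite sum_ffunE (bigD1 j) //= !ffunE eqxx.
rewrite big1 => [|i ij]; rewrite ?addr0; first by rewrite /GRing.scale /= mulr1.
by rewrite !ffunE eq_sym (negPf ij) scaler0.
Qed.

Lemma sums_compP x (a : {ffun I -> k^o}) :
  reflect (forall i, deg i != x -> a i = 0) (a \in sums_comp x).
Proof.
apply: (iffP idP) => [/memv_sumP[vs vsP -> i ix]|a0].
  rewrite sum_ffunE big1 // => j jx; have /vlineP[c ->] := vsP j jx.
  rewrite !ffunE; case: eqP => [ij|]; last by rewrite scaler0.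
  by rewrite ij jx in ix.
rewrite [a]ffun_dl (bigID (fun i => deg i == x)) /= addrC big1 ?add0r.
  by apply: memv_sumr => i _; apply/vlineP; exists (a i).
by move=> i ix; rewrite a0 // scale0r.
Qed.

Let Pf x (a : {ffun I -> k^o}) : {ffun I -> k^o} :=
  [ffun i => if deg i == x then a i else 0].

Let Pf_linear x : linear (Pf x).
Proof.
move=> c a b; apply/ffunP => i; rewrite !ffunE; case: ifP => // _.
by rewrite scaler0 addr0.
Qed.

HB.instance Definition _ x :=
  GRing.isLinear.Build k {ffun I -> k^o} {ffun I -> k^o} _ (Pf x) (Pf_linear x).

Lemma sums_gr : is_grading sums_comp.
Proof.
apply: (@gr_of_proj {ffun I -> k^o} sums_comp (fun x => linfun (Pf x))).
- by move=> x a; rewrite lfunE /=; apply/sums_compP => i ix; rewrite ffunE (negPf ix).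
- move=> a; apply/ffunP => i; rewrite sum_ffunE (bigD1 (deg i)) //= lfunE ffunE eqxx.
  by rewrite big1 ?addr0 // => x /negPf ix; rewrite lfunE ffunE eq_sym ix.
- move=> x y xy a /sums_compP a0; rewrite lfunE; apply/ffunP => i; rewrite !ffunE.
  by case: eqP => // ix; rewrite a0 // ix.
Qed.

Definition gsums : grVect := GrVect sums_gr.

Lemma dl_in i : dl i \in gcomp gsums (deg i).
Proof.
by apply/sums_compP => j; rewrite ffunE; case: (j =P i) => // ->; rewrite eqxx.
Qed.

End SumSimple.

Section Hom.
Variables V W : grVect.

Definition grpart (f : 'Hom(V, W)) : 'Hom(V, W) :=
  \sum_g (gproj W g \o f \o gproj V g)%VF.

Lemma grpart_linear : linear grpart.
Proof.
move=> a f f'; rewrite /grpart scaler_sumr -big_split; apply: eq_bigr => g _ /=.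
by rewrite comp_lfunDr comp_lfunDl -comp_lfunZr -comp_lfunZl.
Qed.

HB.instance Definition _ :=
  GRing.isLinear.Build k 'Hom(V, W) 'Hom(V, W) _ grpart grpart_linear.

(* [grhomP] identifies this with the maps sending each V_g into W_g. *)
Definition grhom : {vspace 'Hom(V, W)} := lker (linfun grpart - \1)%VF.

Lemma grpartP (f : 'Hom(V, W)) : reflect (grpart f = f) (f \in grhom).
Proof. by apply: (iffP eqlfunP); rewrite lfunE id_lfunE. Qed.

Lemma grhomP (f : 'Hom(V, W)) :
  reflect (forall g v, v \in gcomp V g -> f v \in gcomp W g) (f \in grhom).
Proof.
apply: (iffP (grpartP f)).
  move=> <- g v Vv; rewrite sum_lfunE (bigD1 g) //= big1.
    by rewrite addr0 !comp_lfunE gproj_in.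
  by move=> h /negPf hg; rewrite !comp_lfunE (gprojE _ Vv) hg !linear0.
move=> fP; apply/lfunP; apply: gr_ext; try exact: lin_hom.
move=> g v Vv; rewrite sum_lfunE (bigD1 g) //= big1 ?addr0.
  by rewrite !comp_lfunE (gprojE _ Vv) eqxx (gprojE _ (fP _ _ Vv)) eqxx.
by move=> h /negPf hg; rewrite !comp_lfunE (gprojE _ Vv) hg !linear0.
Qed.

Definition grHom : vectType k := subvs_of grhom.


Definition mkHom (f : 'Hom(V, W))
    (fP : forall g v, v \in gcomp V g -> f v \in gcomp W g) : grHom :=
  Subvs (introT (grhomP f) fP).

Lemma grHomP (f : grHom) g v : v \in gcomp V g -> vsval f v \in gcomp W g.
Proof. exact/grhomP/subvsP. Qed.

End Hom.

Lemma tens_homog (V W U : grVect) (f : 'Hom(tens V W, U)) :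
    (forall g h v w, v \in gcomp V g -> w \in gcomp W h ->
       f (pt v w) \in gcomp U (g * h)%g) ->
  f \in grhom (gtens V W) U.
Proof.
move=> fP; apply/(@grpartP (gtens V W)); apply/lfunP.
apply: tens_ext; try exact: lin_hom.
move=> g h v w Vv Ww; have VWvw := memv_pt Vv Ww.
rewrite sum_lfunE (bigD1 (g * h)%g) //= big1 ?addr0.
  by rewrite !comp_lfunE (@gprojE (gtens V W) _ _ _ VWvw) eqxx (gprojE _ (fP _ _ _ _ Vv Ww)) eqxx.
move=> x /negPf xgh; rewrite !comp_lfunE (@gprojE (gtens V W) _ _ _ VWvw) xgh.
by rewrite !linear0.
Qed.

Lemma grHom_eq (V W : grVect) (f f' : grHom V W) :
  (forall v, vsval f v = vsval f' v) -> f = f'.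
Proof. by move=> ff'; apply/val_inj/lfunP. Qed.

Definition grid (V : grVect) : grHom V V :=
  @mkHom V V \1%VF (fun g v Vv => etrans (congr1 _ (id_lfunE v)) Vv).

Lemma gridE V v : vsval (grid V) v = v.
Proof. exact: id_lfunE. Qed.

Lemma grcomp_subproof (V W U : grVect) (f : grHom W U) (f' : grHom V W) g v :
  v \in gcomp V g -> (vsval f \o vsval f')%VF v \in gcomp U g.
Proof. by move=> Vv; rewrite comp_lfunE; apply/grHomP/grHomP. Qed.

Definition grcomp V W U (f : grHom W U) (f' : grHom V W) : grHom V U :=
  mkHom (grcomp_subproof f f').

Lemma grcompE V W U (f : grHom W U) (f' : grHom V W) v :
  vsval (grcomp f f') v = vsval f (vsval f' v).
Proof. exact: comp_lfunE. Qed.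

Lemma gtensm_subproof V W V' W' (f : grHom V V') (f' : grHom W W') g X :
  X \in gcomp (gtens V W) g ->
  tmap (vsval f) (vsval f') X \in gcomp (gtens V' W') g.
Proof.
move: g X; apply/grhomP/tens_homog => g h v w Vv Ww.
by rewrite tmapE; apply: memv_pt; apply: grHomP.
Qed.

Definition gtensm V W V' W' (f : grHom V V') (f' : grHom W W') :
  grHom (gtens V W) (gtens V' W') := mkHom (gtensm_subproof f f').

Lemma gtensmE V W V' W' (f : grHom V V') (f' : grHom W W') v w :
  vsval (gtensm f f') (pt v w) = pt (vsval f v) (vsval f' w).
Proof. exact: tmapE. Qed.


(* maps v (x) w (x) u to c g h l *: v (x) w (x) u (re-bracketed) on vectors   *)
(* of degrees g, h, l, see [lassocE] and [lassocVE]                           *)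
Section Associator.
Variables (c : gT -> gT -> gT -> k) (V W U : grVect).

Definition lassoc : 'Hom(tens (tens V W) U, tens V (tens W U)) :=
  tlin (fun X u => tlift (fun v w => \sum_g \sum_h \sum_l
    c g h l *: pt (gproj V g v) (pt (gproj W h w) (gproj U l u))) X).

Definition lassocV : 'Hom(tens V (tens W U), tens (tens V W) U) :=
  tlin (fun v X => tlift (fun w u => \sum_g \sum_h \sum_l
    c g h l *: pt (pt (gproj V g v) (gproj W h w)) (gproj U l u)) X).

Lemma sum3_proj (T : vectType k) (F : V -> W -> U -> T) g h l v w u :
    v \in gcomp V g -> w \in gcomp W h -> u \in gcomp U l ->
    (forall w u, F 0 w u = 0) -> (forall v u, F v 0 u = 0) ->
    (forall v w, F v w 0 = 0) ->
  \sum_g' \sum_h' \sum_l'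
    c g' h' l' *: F (gproj V g' v) (gproj W h' w) (gproj U l' u) =
  c g h l *: F v w u.
Proof.
move=> Vv Ww Uu F1 F2 F3; rewrite (bigD1 g) //= [X in _ + X]big1 ?addr0; last first.
  move=> g' /negPf gg'; rewrite big1 // => h' _; rewrite big1 // => l' _.
  by rewrite (gprojE _ Vv) gg' F1 scaler0.
rewrite (bigD1 h) //= [X in _ + X]big1 ?addr0; last first.
  move=> h' /negPf hh'; rewrite big1 // => l' _.
  by rewrite (gprojE _ Ww) hh' F2 scaler0.
rewrite (bigD1 l) //= [X in _ + X]big1 ?addr0; last first.
  by move=> l' /negPf ll'; rewrite (gprojE _ Uu) ll' F3 scaler0.
by rewrite (gprojE _ Vv) (gprojE _ Ww) (gprojE _ Uu) !eqxx.
Qed.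

Lemma lassocE g h l v w u :
    v \in gcomp V g -> w \in gcomp W h -> u \in gcomp U l ->
  lassoc (pt (pt v w) u) = c g h l *: pt v (pt w u).
Proof.
move=> Vv Ww Uu; rewrite tlinE; last first.
  split=> [u'|X]; first exact: tlift_linear.
  apply: lin_tlift => v' w'; do 3 apply: lin_sum => ?.
  exact/lin_scale/lin_ptr/lin_ptr/lin_hom.
rewrite tlift_pt; last first.
  split=> v'; do 3 apply: lin_sum => ?; apply: lin_scale.
    exact/lin_ptl/lin_hom.
  exact/lin_ptr/lin_ptl/lin_hom.
by rewrite (sum3_proj (F := fun v w u => pt v (pt w u)) Vv Ww Uu) // => *;
  rewrite ?pt0l ?pt0r ?pt0l ?pt0r.
Qed.

Lemma lassocVE g h l v w u :
    v \in gcomp V g -> w \in gcomp W h -> u \in gcomp U l ->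
  lassocV (pt v (pt w u)) = c g h l *: pt (pt v w) u.
Proof.
move=> Vv Ww Uu; rewrite tlinE; last first.
  split=> [X|v']; last exact: tlift_linear.
  apply: lin_tlift => v' w'; do 3 apply: lin_sum => ?.
  exact/lin_scale/lin_ptl/lin_ptl/lin_hom.
rewrite tlift_pt; last first.
  split=> v'; do 3 apply: lin_sum => ?; apply: lin_scale.
    exact/lin_ptl/lin_ptr/lin_hom.
  exact/lin_ptr/lin_hom.
by rewrite (sum3_proj (F := fun v w u => pt (pt v w) u) Vv Ww Uu) // => *;
  rewrite ?pt0l ?pt0r ?pt0l ?pt0r.
Qed.

End Associator.

Lemma tens3_ext (V W U : grVect) (T : vectType k)
    (f f' : tens (tens V W) U -> T) :
    linear f -> linear f' ->
    (forall g h l v w u, v \in gcomp V g -> w \in gcomp W h ->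
       u \in gcomp U l -> f (pt (pt v w) u) = f' (pt (pt v w) u)) ->
  forall X, f X = f' X.
Proof.
move=> lf lf' ff'; apply: (@tens_ext (gtens V W) U) => // _ l X u _ Uu.
apply: (@tens_ext V W _ (fun X => f (pt X u)) (fun X => f' (pt X u))).
- exact/(lin_comp lf)/lin_ptl/lin_id.
- exact/(lin_comp lf')/lin_ptl/lin_id.
by move=> g h v w Vv Ww; apply: ff' Vv Ww Uu.
Qed.

Lemma tens3V_ext (V W U : grVect) (T : vectType k)
    (f f' : tens V (tens W U) -> T) :
    linear f -> linear f' ->
    (forall g h l v w u, v \in gcomp V g -> w \in gcomp W h ->
       u \in gcomp U l -> f (pt v (pt w u)) = f' (pt v (pt w u))) ->
  forall X, f X = f' X.
Proof.
move=> lf lf' ff'; apply: (@tens_ext V (gtens W U)) => // g _ v X Vv _.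
apply: (@tens_ext W U _ (fun X => f (pt v X)) (fun X => f' (pt v X))).
- exact/(lin_comp lf)/lin_ptr/lin_id.
- exact/(lin_comp lf')/lin_ptr/lin_id.
by move=> h l w u Ww Uu; apply: ff' Vv Ww Uu.
Qed.

Lemma lassoc_subproof c (V W U : grVect) g X :
  X \in gcomp (gtens (gtens V W) U) g ->
  lassoc c V W U X \in gcomp (gtens V (gtens W U)) g.
Proof.
move: g X; apply/grhomP/(@grpartP (gtens (gtens V W) U) (gtens V (gtens W U))).
apply/lfunP; apply: tens3_ext; try exact: lin_hom.
move=> g h l v w u Vv Ww Uu.
have VWU := @memv_pt (gtens V W) U _ _ _ _ (memv_pt Vv Ww) Uu.
have VWU' := @memv_pt V (gtens W U) _ _ _ _ Vv (memv_pt Ww Uu).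
rewrite sum_lfunE (bigD1 (g * h * l)%g) //= big1 ?addr0.
  rewrite !comp_lfunE (@gprojE (gtens (gtens V W) U) _ _ _ VWU) eqxx.
  rewrite (lassocE c Vv Ww Uu) linearZ /=.
  by rewrite (@gprojE (gtens V (gtens W U)) _ _ _ VWU') mulgA eqxx.
move=> x /negPf xghl; rewrite !comp_lfunE.
by rewrite (@gprojE (gtens (gtens V W) U) _ _ _ VWU) xghl !linear0.
Qed.

Lemma lassocV_subproof c (V W U : grVect) g X :
  X \in gcomp (gtens V (gtens W U)) g ->
  lassocV c V W U X \in gcomp (gtens (gtens V W) U) g.
Proof.
move: g X; apply/grhomP/(@grpartP (gtens V (gtens W U)) (gtens (gtens V W) U)).
apply/lfunP; apply: tens3V_ext; try exact: lin_hom.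
move=> g h l v w u Vv Ww Uu.
have VWU := @memv_pt (gtens V W) U _ _ _ _ (memv_pt Vv Ww) Uu.
have VWU' := @memv_pt V (gtens W U) _ _ _ _ Vv (memv_pt Ww Uu).
rewrite sum_lfunE (bigD1 (g * (h * l))%g) //= big1 ?addr0.
  rewrite !comp_lfunE (@gprojE (gtens V (gtens W U)) _ _ _ VWU') eqxx.
  rewrite (lassocVE c Vv Ww Uu) linearZ /=.
  by rewrite (@gprojE (gtens (gtens V W) U) _ _ _ VWU) mulgA eqxx.
move=> x /negPf xghl; rewrite !comp_lfunE.
by rewrite (@gprojE (gtens V (gtens W U)) _ _ _ VWU') xghl !linear0.
Qed.

(* maps a (x) v and v (x) a to (a * c g) *: v for v of degree g *)
Section Unitors.
Variables (c : gT -> k) (V : grVect).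

Definition llunit : 'Hom(tens gone V, V) :=
  tlin (fun (a : k^o) (v : V) => \sum_g (a * c g) *: gproj V g v).

Definition llunitV : 'Hom(V, tens gone V) :=
  \sum_g c g *: (ptl V (1 : k^o) \o gproj V g)%VF.

Definition lrunit : 'Hom(tens V gone, V) :=
  tlin (fun (v : V) (a : k^o) => \sum_g (a * c g) *: gproj V g v).

Definition lrunitV : 'Hom(V, tens V gone) :=
  \sum_g c g *: (ptr V (1 : k^o) \o gproj V g)%VF.

Lemma sum_proj (T : vectType k) (b : gT -> k) (F : V -> T) g v :
  v \in gcomp V g -> F 0 = 0 ->
  \sum_g' b g' *: F (gproj V g' v) = b g *: F v.
Proof.
move=> Vv F0; rewrite (bigD1 g) //= big1 ?addr0 ?(gprojE _ Vv) ?eqxx //.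
by move=> g' /negPf gg'; rewrite (gprojE _ Vv) gg' F0 scaler0.
Qed.

Lemma simple_comp_neq g x a :
  a \in gcomp (gsimple g) x -> x != g -> a = 0.
Proof. by move=> /= + /negPf xg; rewrite /simple_comp xg memv0 => /eqP. Qed.

Lemma llunitE g (a : k^o) v :
  v \in gcomp V g -> llunit (pt a v : tens gone V) = (a * c g) *: v.
Proof.
move=> Vv; rewrite tlinE; last first.
  split=> [v'|a']; last by apply: lin_sum => g'; apply/lin_scale/lin_hom.
  by apply: lin_sum => g' b x y; rewrite scalerA -scalerDl mulrDl mulrA.
exact: (sum_proj (fun g => a * c g) (F := id)).
Qed.

Lemma lrunitE g (a : k^o) v :
  v \in gcomp V g -> lrunit (pt v a : tens V gone) = (a * c g) *: v.
Proof.
move=> Vv; rewrite tlinE; last first.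
  split=> [v'|a']; first by apply: lin_sum => g'; apply/lin_scale/lin_hom.
  by apply: lin_sum => g' b x y; rewrite scalerA -scalerDl mulrDl mulrA.
exact: (sum_proj (fun g => a * c g) (F := id)).
Qed.

Lemma llunitVE g v : v \in gcomp V g -> llunitV v = c g *: pt (1 : k^o) v.
Proof.
move=> Vv; rewrite sum_lfunE.
under eq_bigr => g' _ do rewrite scale_lfunE comp_lfunE ptlE.
by rewrite (sum_proj c (F := fun v => pt (1 : k^o) v) Vv) // pt0r.
Qed.

Lemma lrunitVE g v : v \in gcomp V g -> lrunitV v = c g *: pt v (1 : k^o).
Proof.
move=> Vv; rewrite sum_lfunE.
under eq_bigr => g' _ do rewrite scale_lfunE comp_lfunE ptrE.
by rewrite (sum_proj c (F := fun v => pt v (1 : k^o)) Vv) // pt0l.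
Qed.

Lemma gsimple1_in : (1 : k^o) \in gcomp gone 1%g.
Proof. by rewrite /= /simple_comp eqxx memvf. Qed.

Lemma llunit_subproof g X :
  X \in gcomp (gtens gone V) g -> llunit X \in gcomp V g.
Proof.
move: g X; apply/grhomP/tens_homog => g h a v Va Vv.
rewrite (llunitE _ Vv); case: (g =P 1%g) => [->|/eqP g1].
  by rewrite mul1g rpredZ.
by rewrite (simple_comp_neq Va g1) mul0r scale0r rpred0.
Qed.

Lemma lrunit_subproof g X :
  X \in gcomp (gtens V gone) g -> lrunit X \in gcomp V g.
Proof.
move: g X; apply/grhomP/tens_homog => h g v a Vv Va.
rewrite (lrunitE _ Vv); case: (g =P 1%g) => [->|/eqP g1].
  by rewrite mulg1 rpredZ.
by rewrite (simple_comp_neq Va g1) mul0r scale0r rpred0.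
Qed.

Lemma llunitV_subproof g v :
  v \in gcomp V g -> llunitV v \in gcomp (gtens gone V) g.
Proof.
move=> Vv; rewrite (llunitVE Vv) rpredZ // -[g]mul1g.
exact: (memv_pt gsimple1_in Vv).
Qed.

Lemma lrunitV_subproof g v :
  v \in gcomp V g -> lrunitV v \in gcomp (gtens V gone) g.
Proof.
move=> Vv; rewrite (lrunitVE Vv) rpredZ // -[g]mulg1.
exact: (memv_pt Vv gsimple1_in).
Qed.

End Unitors.

Definition nz_cochain3 (w : gT -> gT -> gT -> k) : Prop :=
  forall x y z, w x y z != 0.

Definition cocycle3 (w : gT -> gT -> gT -> k) : Prop :=
  forall x1 x2 x3 x4,
    w (x1 * x2)%g x3 x4 * w x1 x2 (x3 * x4)%g =
    w x1 x2 x3 * w x1 (x2 * x3)%g x4 * w x2 x3 x4.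

Definition normalized3 (w : gT -> gT -> gT -> k) : Prop :=
  forall x y, [/\ w 1%g x y = 1, w x 1%g y = 1 & w x y 1%g = 1].

Definition normalized_cocycle3 (w : gT -> gT -> gT -> k) : Prop :=
  [/\ nz_cochain3 w, cocycle3 w & normalized3 w].

Section VecG.
Variables (w : gT -> gT -> gT -> k) (hw : normalized_cocycle3 w).

Definition gassoc (V W U : grVect) :
    grHom (gtens (gtens V W) U) (gtens V (gtens W U)) :=
  mkHom (@lassoc_subproof (fun g h l => (w g h l)^-1) V W U).

Definition gassocV (V W U : grVect) :
    grHom (gtens V (gtens W U)) (gtens (gtens V W) U) :=
  mkHom (@lassocV_subproof w V W U).

Definition glunit (V : grVect) : grHom (gtens gone V) V :=
  mkHom (@llunit_subproof (fun g => (w 1%g 1%g g)^-1) V).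

Definition glunitV (V : grVect) : grHom V (gtens gone V) :=
  mkHom (@llunitV_subproof (fun g => w 1%g 1%g g) V).

Definition grunit (V : grVect) : grHom (gtens V gone) V :=
  mkHom (@lrunit_subproof (fun g => w g 1%g 1%g) V).

Definition grunitV (V : grVect) : grHom V (gtens V gone) :=
  mkHom (@lrunitV_subproof (fun g => (w g 1%g 1%g)^-1) V).

Section HomogEval.
Variables (V W U : grVect) (g h l : gT) (v : V) (v' : W) (v'' : U).
Hypotheses (Vv : v \in gcomp V g) (Wv : v' \in gcomp W h).
Hypothesis (Uv : v'' \in gcomp U l).

Lemma gassocE : vsval (gassoc V W U) (pt (pt v v') v'') =
  (w g h l)^-1 *: pt v (pt v' v'').
Proof. exact: (lassocE (fun g h l => (w g h l)^-1) Vv Wv Uv). Qed.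

Lemma gassocVE : vsval (gassocV V W U) (pt v (pt v' v'')) =
  w g h l *: pt (pt v v') v''.
Proof. exact: (lassocVE w Vv Wv Uv). Qed.

Lemma glunitE (a : k^o) : vsval (glunit V) (pt a v) = (a / w 1%g 1%g g) *: v.
Proof. exact: (llunitE (fun g => (w 1%g 1%g g)^-1) a Vv). Qed.

Lemma glunitVE : vsval (glunitV V) v = w 1%g 1%g g *: pt (1 : k^o) v.
Proof. exact: (llunitVE (fun g => w 1%g 1%g g) Vv). Qed.

Lemma grunitE (a : k^o) : vsval (grunit V) (pt v a) = (a * w g 1%g 1%g) *: v.
Proof. exact: (lrunitE (fun g => w g 1%g 1%g) a Vv). Qed.

Lemma grunitVE : vsval (grunitV V) v = (w g 1%g 1%g)^-1 *: pt v (1 : k^o).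
Proof. exact: (lrunitVE (fun g => (w g 1%g 1%g)^-1) Vv). Qed.

End HomogEval.

Let w0 : nz_cochain3 w. Proof. by case: hw. Qed.

Lemma grHomZ (V W : grVect) (f : grHom V W) c v :
  vsval f (c *: v) = c *: vsval f v.
Proof. exact: linearZ. Qed.

Lemma grcomp1l V W (f : grHom V W) : grcomp (grid W) f = f.
Proof. by apply: grHom_eq => v; rewrite grcompE gridE. Qed.

Lemma grcomp1r V W (f : grHom V W) : grcomp f (grid V) = f.
Proof. by apply: grHom_eq => v; rewrite grcompE gridE. Qed.

Lemma grcompA V W U T (f : grHom U T) (f' : grHom W U) (f'' : grHom V W) :
  grcomp f (grcomp f' f'') = grcomp (grcomp f f') f''.
Proof. by apply: grHom_eq => v; rewrite !grcompE. Qed.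

Lemma grHomDE V W (a : k) (f f' : grHom V W) v :
  vsval (a *: f + f') v = a *: vsval f v + vsval f' v.
Proof. by rewrite /= add_lfunE scale_lfunE. Qed.

Lemma grcompDl V W U (a : k) (f f' : grHom W U) (f'' : grHom V W) :
  grcomp (a *: f + f') f'' = a *: grcomp f f'' + grcomp f' f''.
Proof. by apply: grHom_eq => v; rewrite grHomDE !grcompE grHomDE. Qed.

Lemma grcompDr V W U (a : k) (f : grHom W U) (f' f'' : grHom V W) :
  grcomp f (a *: f' + f'') = a *: grcomp f f' + grcomp f f''.
Proof. by apply: grHom_eq => v; rewrite grHomDE !grcompE grHomDE linearP. Qed.

Lemma gtens_eq V W U (f f' : grHom (gtens V W) U) :
  (forall v v', vsval f (pt v v') = vsval f' (pt v v')) -> f = f'.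
Proof. by move=> ff'; apply/val_inj/tensP. Qed.

Lemma gtensm1 V W : gtensm (grid V) (grid W) = grid (gtens V W).
Proof. by apply: gtens_eq => v v'; rewrite gtensmE !gridE. Qed.

Lemma gtensm_comp V W U V' W' U' (f : grHom W U) (g : grHom V W)
    (f' : grHom W' U') (g' : grHom V' W') :
  gtensm (grcomp f g) (grcomp f' g') = grcomp (gtensm f f') (gtensm g g').
Proof. by apply: gtens_eq => v v'; rewrite grcompE !gtensmE !grcompE. Qed.

Lemma gtensmDl V W V' W' (a : k) (f f' : grHom V V') (g : grHom W W') :
  gtensm (a *: f + f') g = a *: gtensm f g + gtensm f' g.
Proof.
by apply: gtens_eq => v v'; rewrite grHomDE !gtensmE grHomDE (pt_bilin _ _).1.
Qed.

Lemma gtensmDr V W V' W' (a : k) (f : grHom V V') (g g' : grHom W W') :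
  gtensm f (a *: g + g') = a *: gtensm f g + gtensm f g'.
Proof.
by apply: gtens_eq => v v'; rewrite grHomDE !gtensmE grHomDE (pt_bilin _ _).2.
Qed.

Lemma gassocK V W U :
  grcomp (gassocV V W U) (gassoc V W U) = grid (gtens (gtens V W) U).
Proof.
apply: grHom_eq; apply: tens3_ext; try exact: lin_hom.
move=> g h l v v' v'' Vv Wv Uv; rewrite grcompE gridE (gassocE Vv Wv Uv).
by rewrite grHomZ (gassocVE Vv Wv Uv) scalerA mulVf ?scale1r.
Qed.

Lemma gassocVK V W U :
  grcomp (gassoc V W U) (gassocV V W U) = grid (gtens V (gtens W U)).
Proof.
apply: grHom_eq; apply: tens3V_ext; try exact: lin_hom.
move=> g h l v v' v'' Vv Wv Uv; rewrite grcompE gridE (gassocVE Vv Wv Uv).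
by rewrite grHomZ (gassocE Vv Wv Uv) scalerA mulfV ?scale1r.
Qed.

Lemma gassoc_nat V W U V' W' U'
    (f : grHom V V') (f' : grHom W W') (f'' : grHom U U') :
  grcomp (gassoc V' W' U') (gtensm (gtensm f f') f'') =
  grcomp (gtensm f (gtensm f' f'')) (gassoc V W U).
Proof.
apply: grHom_eq; apply: tens3_ext; try exact: lin_hom.
move=> g h l v v' v'' Vv Wv Uv; rewrite !grcompE (gassocE Vv Wv Uv).
rewrite grHomZ !gtensmE.
exact: (gassocE (grHomP f Vv) (grHomP f' Wv) (grHomP f'' Uv)).
Qed.

Lemma gone_tensl_eq V U (f f' : grHom (gtens gone V) U) :
    (forall (a : k^o) g v, v \in gcomp V g ->
      vsval f (pt a v) = vsval f' (pt a v)) -> f = f'.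
Proof.
move=> ff'; apply: gtens_eq => a.
apply: (@gr_ext V _ (fun v => vsval f (pt a v)) (fun v => vsval f' (pt a v))).
- by move=> c x y; rewrite (pt_bilin gone V).2; apply: linearP.
- by move=> c x y; rewrite (pt_bilin gone V).2; apply: linearP.
by move=> g v Vv; apply: ff' Vv.
Qed.

Lemma gone_tensr_eq V U (f f' : grHom (gtens V gone) U) :
    (forall (a : k^o) g v, v \in gcomp V g ->
      vsval f (pt v a) = vsval f' (pt v a)) -> f = f'.
Proof.
move=> ff'; apply: gtens_eq => v a; move: v.
apply: (@gr_ext V _ (fun v => vsval f (pt v a)) (fun v => vsval f' (pt v a))).
- by move=> c x y; rewrite (pt_bilin V gone).1; apply: linearP.
- by move=> c x y; rewrite (pt_bilin V gone).1; apply: linearP.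
by move=> g v Vv; apply: ff' Vv.
Qed.

Lemma grHom_homog_eq (V U : grVect) (f f' : grHom V U) :
  (forall g v, v \in gcomp V g -> vsval f v = vsval f' v) -> f = f'.
Proof. by move=> ff'; apply: grHom_eq; apply: gr_ext => //; apply: lin_hom. Qed.

Let k_scale1 (a : k^o) : a = a *: (1 : k^o).
Proof. by rewrite /GRing.scale /= mulr1. Qed.

Lemma glunitK V : grcomp (glunitV V) (glunit V) = grid (gtens gone V).
Proof.
apply: gone_tensl_eq => a g v Vv; rewrite grcompE gridE (glunitE Vv) grHomZ.
by rewrite (glunitVE Vv) scalerA divfK // -ptZl -k_scale1.
Qed.

Lemma glunitVK V : grcomp (glunit V) (glunitV V) = grid V.
Proof.
apply: grHom_homog_eq => g v Vv; rewrite grcompE gridE (glunitVE Vv) grHomZ.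
by rewrite (glunitE Vv) scalerA mul1r mulfV ?scale1r.
Qed.

Lemma glunit_nat V W (f : grHom V W) :
  grcomp (glunit W) (gtensm (grid gone) f) = grcomp f (glunit V).
Proof.
apply: gone_tensl_eq => a g v Vv; rewrite !grcompE (glunitE Vv) grHomZ.
by rewrite gtensmE gridE (glunitE (grHomP f Vv)).
Qed.

Lemma grunitK V : grcomp (grunitV V) (grunit V) = grid (gtens V gone).
Proof.
apply: gone_tensr_eq => a g v Vv; rewrite grcompE gridE (grunitE Vv) grHomZ.
by rewrite (grunitVE Vv) scalerA mulfK // -ptZr -k_scale1.
Qed.

Lemma grunitVK V : grcomp (grunit V) (grunitV V) = grid V.
Proof.
apply: grHom_homog_eq => g v Vv; rewrite grcompE gridE (grunitVE Vv) grHomZ.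
by rewrite (grunitE Vv) scalerA mul1r mulVf ?scale1r.
Qed.

Lemma grunit_nat V W (f : grHom V W) :
  grcomp (grunit W) (gtensm f (grid gone)) = grcomp f (grunit V).
Proof.
apply: gone_tensr_eq => a g v Vv; rewrite !grcompE (grunitE Vv) grHomZ.
by rewrite gtensmE gridE (grunitE (grHomP f Vv)).
Qed.

Lemma gpentagon V W U T :
  grcomp (gassoc V W (gtens U T)) (gassoc (gtens V W) U T) =
  grcomp (gtensm (grid V) (gassoc W U T))
    (grcomp (gassoc V (gtens W U) T) (gtensm (gassoc V W U) (grid T))).
Proof.
apply: grHom_eq.
apply: (@tens3_ext (gtens V W) U T); try exact: lin_hom.
move=> gh x y X u t _ Uu Tt; move: X.
have lin_f (f : grHom (gtens (gtens (gtens V W) U) T)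
                      (gtens V (gtens W (gtens U T)))) :
    linear (fun X : tens V W => vsval f (pt (pt X u) t)).
  move=> c A B; rewrite (pt_bilin (gtens V W) U).1.
  by rewrite (pt_bilin (gtens (gtens V W) U) T).1; apply: linearP.
apply: (tens_ext (lin_f _) (lin_f _)) => g h v w' Vv Ww.
rewrite !grcompE gtensmE gridE.
rewrite (gassocE (memv_pt Vv Ww : _ \in gcomp (gtens V W) _) Uu Tt) grHomZ.
rewrite (gassocE Vv Ww (memv_pt Uu Tt : _ \in gcomp (gtens U T) _)).
rewrite (gassocE Vv Ww Uu) ptZl 2!grHomZ.
rewrite (gassocE Vv (memv_pt Ww Uu : _ \in gcomp (gtens W U) _) Tt) grHomZ.
rewrite gtensmE gridE (gassocE Ww Uu Tt) ptZr !scalerA -!invfM.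
by case: hw => _ -> _.
Qed.

Lemma gtriangle V W :
  grcomp (gtensm (grid V) (glunit W)) (gassoc V gone W) =
  gtensm (grunit V) (grid W).
Proof.
apply: grHom_eq.
apply: (@tens3_ext V gone W); try exact: lin_hom.
move=> g x h v a w' Vv xa Ww; rewrite grcompE gtensmE gridE (grunitE Vv).
rewrite (gassocE Vv xa Ww) grHomZ gtensmE gridE (glunitE Ww).
case: (x =P 1%g) => [->|/eqP x1]; last first.
  by rewrite (simple_comp_neq xa x1) !mul0r !scale0r pt0l pt0r scaler0.
case: hw => _ _ w1; have [_ -> _] := w1 g h; have [-> _ _] := w1 1%g h.
by have [_ -> _] := w1 g 1%g; rewrite invr1 mulr1 scale1r ptZl ptZr.
Qed.

Definition VecG : monCat k :=
  @MonCat k grVect grHom grid grcomp gtens gtensm gone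
    gassoc gassocV glunit glunitV grunit grunitV
    grcomp1l grcomp1r grcompA grcompDl grcompDr
    gtensm1 gtensm_comp gtensmDl gtensmDr
    gassocK gassocVK gassoc_nat
    glunitK glunitVK glunit_nat grunitK grunitVK grunit_nat
    gpentagon gtriangle.

End VecG.

(* 2-cochains on L are functions on the group type [subg_of L] of elements of *)
(* L.                                                                         *)
Section TwistedGroupAlgebra.
Variable L : {group gT}.

Definition nz_cochain2 (psi : subg_of L -> subg_of L -> k) : Prop :=
  forall f1 f2, psi f1 f2 != 0.

Definition normalized2 (psi : subg_of L -> subg_of L -> k) : Prop :=
  forall f, psi 1%g f = 1 /\ psi f 1%g = 1.

(* d psi = w on L *)
Definition cobounds (psi : subg_of L -> subg_of L -> k)
    (w : gT -> gT -> gT -> k) : Prop :=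
  forall f1 f2 f3,
    psi f1 (f2 * f3)%g * psi f2 f3 =
    w (sgval f1) (sgval f2) (sgval f3) * psi (f1 * f2)%g f3 * psi f1 f2.

Definition trivial_class_on (w : gT -> gT -> gT -> k) : Prop :=
  exists2 psi, nz_cochain2 psi & cobounds psi w.

Definition twalg : grVect := gsums (@sgval gT L).

Variable psi : subg_of L -> subg_of L -> k.

Definition twmul_lin : 'Hom(tens twalg twalg, twalg) :=
  tlin (fun a b : {ffun subg_of L -> k^o} =>
    \sum_f \sum_g (a f * b g * psi f g) *: dl (f * g)%g).

Lemma twmul_linE (a b : {ffun subg_of L -> k^o}) :
  twmul_lin (pt a b : tens twalg twalg) =
  \sum_f \sum_g (a f * b g * psi f g) *: dl (f * g)%g.
Proof.
rewrite tlinE //; split=> [b' c x y|a' c x y].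
  rewrite scaler_sumr -big_split /=; apply: eq_bigr => f _.
  rewrite scaler_sumr -big_split /=; apply: eq_bigr => g _.
  by rewrite !ffunE scalerA -scalerDl !mulrDl !mulrA.
rewrite scaler_sumr -big_split /=; apply: eq_bigr => f _.
rewrite scaler_sumr -big_split /=; apply: eq_bigr => g _.
by rewrite !ffunE scalerA -scalerDl mulrDr mulrDl !mulrA (mulrC c).
Qed.

Lemma twmul_subproof x X :
  X \in gcomp (gtens twalg twalg) x -> twmul_lin X \in gcomp twalg x.
Proof.
move: x X; apply/grhomP/tens_homog => x y a b /sums_compP a0 /sums_compP b0.
rewrite twmul_linE; apply: rpred_sum => f _; apply: rpred_sum => g _.
have [fx|/a0->] := eqVneq (sgval f) x; last by rewrite !mul0r scale0r rpred0.
have [gy|/b0->] := eqVneq (sgval g) y; last by rewrite mulr0 mul0r scale0r rpred0.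
by rewrite rpredZ // -fx -gy; apply: (dl_in (@sgval gT L) (f * g)%g).
Qed.

Definition twmul : grHom (gtens twalg twalg) twalg := mkHom twmul_subproof.

Lemma twmul_dl f g :
  vsval twmul (pt (dl f) (dl g)) = psi f g *: dl (f * g)%g.
Proof.
rewrite (twmul_linE (dl f) (dl g)) (bigD1 f) //= [X in _ + X]big1 ?addr0.
  rewrite (bigD1 g) //= [X in _ + X]big1 ?addr0 ?ffunE ?eqxx ?mul1r //.
  by move=> h /negPf hg; rewrite !ffunE hg mulr0 mul0r scale0r.
move=> h /negPf hf; rewrite big1 // => g' _.
by rewrite !ffunE hf !mul0r scale0r.
Qed.

Variables (w : gT -> gT -> gT -> k) (hw : normalized_cocycle3 w).

Definition TwAlg : VecG hw := twalg.

Definition TwMul : mhom (TwAlg \ox TwAlg) TwAlg := twmul.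

End TwistedGroupAlgebra.

End Graded.

(* Main.v *)
Require Import Defs.
From HB Require Import structures.
From mathcomp Require Import all_boot all_order all_algebra all_fingroup.

Set Implicit Arguments.
Unset Strict Implicit.
Unset Printing Implicit Defensive.

Import GRing.Theory.
Local Open Scope ring_scope.

(* The unit sends [1] to [delta_e], the counit is [|L|] times the coefficient *)
(* at [delta_e], and the comultiplication is                                  *)
(*   [delta_f |-> |L|^-1 \sum_(g h = f) psi(g, h)^-1 delta_g (x) delta_h].    *)
(* On basis vectors each axiom becomes, after reindexing the sums over L, an  *)
(* instance of [d psi = w].  The factor [|L|^-1], which exists in             *)
(* characteristic 0, gives [m \oc D = id], and then [e \oc u = |L|].          *)

(** Every homogeneous piece of the twisted group algebra is zero or a line, and the product
    identifies delta_g (x) delta_h with delta_(g h) up to the nonzero scalar [psi g h]. The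
    comultiplication averages the inverses of these identifications over the |L| factorizations of
    an element of L, so multiplying afterwards gives back the identity ([twmul_comul]). The
    remaining three-factor axioms are all the relation d psi = w: read directly it is associativity
    ([twmulA]), inverted it is coassociativity ([twcomulA]), and with factors moved across it is
    each Frobenius identity ([twfrobeniusl], [twfrobeniusr]). The unit and counit laws come from the
    normalization of psi and w. Connectedness holds because delta_e occurs exactly once in the
    algebra ([twconnected]). *)

Section HomsFromSums.
Variables (k : fieldType) (gT : finGroupType).

Lemma gsums_ext (I : finType) (deg : I -> gT) (U : vectType k)
    (f f' : 'Hom(gsums k deg, U)) :
  (forall i, f (dl k i) = f' (dl k i)) -> forall a, f a = f' a.
Proof.
move=> ff' a; rewrite [a]ffun_dl !linear_sum; apply: eq_bigr => i _.
by rewrite !linearZ /= ff'.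
Qed.

Lemma gsums_hom_eq (I : finType) (deg : I -> gT) (U : grVect k gT)
    (f f' : grHom (gsums k deg) U) :
  (forall i, vsval f (dl k i) = vsval f' (dl k i)) -> f = f'.
Proof. by move=> ff'; apply/grHom_eq/gsums_ext. Qed.

Lemma gsums2_hom_eq (I J : finType) (degI : I -> gT) (degJ : J -> gT)
    (U : grVect k gT) (f f' : grHom (gtens (gsums k degI) (gsums k degJ)) U) :
    (forall i j, vsval f (pt (dl k i) (dl k j)) =
                 vsval f' (pt (dl k i) (dl k j))) ->
  f = f'.
Proof.
move=> ff'; apply: gtens_eq => a b.
rewrite -!ptrE -!comp_lfunE; apply: gsums_ext => i.
rewrite !comp_lfunE !ptrE -!ptlE -!comp_lfunE; apply: gsums_ext => j.
by rewrite !comp_lfunE !ptlE.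
Qed.

(** Freezing all factors but one leaves a linear map on a single sum, so basis vectors can be tested
    one factor at a time. This turns associativity into an identity of scalars. *)
Lemma gsums3_hom_eq (I J K : finType) (degI : I -> gT) (degJ : J -> gT)
    (degK : K -> gT) (U : grVect k gT)
    (f f' : grHom (gtens (gtens (gsums k degI) (gsums k degJ)) (gsums k degK)) U) :
    (forall i j l, vsval f (pt (pt (dl k i) (dl k j)) (dl k l)) =
                   vsval f' (pt (pt (dl k i) (dl k j)) (dl k l))) ->
  f = f'.
Proof.
move=> ff'; apply: gtens_eq => X c; rewrite -!ptlE -!comp_lfunE; move: c.
apply: gsums_ext => l; rewrite !comp_lfunE !ptlE -!ptrE -!comp_lfunE.
move: X; apply/lfunP/tensP => a b; rewrite -!ptrE -!comp_lfunE.
move: a; apply: gsums_ext => i; rewrite !comp_lfunE !ptrE.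
rewrite -[pt _ b]ptlE -!ptrE -!comp_lfunE; move: b; apply: gsums_ext => j.
by rewrite !comp_lfunE !ptrE !ptlE.
Qed.

Lemma gone_gsums_hom_eq (I : finType) (deg : I -> gT) (U : grVect k gT)
    (f f' : grHom (gtens (gone k gT) (gsums k deg)) U) :
    (forall (a : k^o) i, vsval f (pt a (dl k i)) = vsval f' (pt a (dl k i))) ->
  f = f'.
Proof.
move=> ff'; apply: gtens_eq => a b; rewrite -!ptlE -!comp_lfunE.
by apply: gsums_ext => i; rewrite !comp_lfunE !ptlE.
Qed.

Lemma gsums_gone_hom_eq (I : finType) (deg : I -> gT) (U : grVect k gT)
    (f f' : grHom (gtens (gsums k deg) (gone k gT)) U) :
    (forall (a : k^o) i, vsval f (pt (dl k i) a) = vsval f' (pt (dl k i) a)) ->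
  f = f'.
Proof.
move=> ff'; apply: gtens_eq => b a; rewrite -!ptrE -!comp_lfunE.
by apply: gsums_ext => i; rewrite !comp_lfunE !ptrE.
Qed.

Section Extension.
Variables (I : finType) (deg : I -> gT) (U : grVect k gT) (F : I -> U).

Definition sums_lift (a : {ffun I -> k^o}) : U := \sum_i a i *: F i.

Lemma sums_lift_linear : linear sums_lift.
Proof.
apply: lin_sum => i c a b.
by rewrite !ffunE scalerDl scalerA.
Qed.

HB.instance Definition _ :=
  GRing.isLinear.Build k {ffun I -> k^o} U _ sums_lift sums_lift_linear.

Lemma sums_lift_dl i : sums_lift (dl k i) = F i.
Proof.
rewrite /sums_lift (bigD1 i) //= ffunE eqxx scale1r big1 ?addr0 // => j /negPf ji.
by rewrite ffunE ji scale0r.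
Qed.

Hypothesis Fdeg : forall i, F i \in gcomp U (deg i).

Lemma sums_lift_subproof x a :
  a \in gcomp (gsums k deg) x ->
  (linfun sums_lift : 'Hom(gsums k deg, U)) a \in gcomp U x.
Proof.
move=> /sums_compP a0; rewrite lfunE; apply: rpred_sum => i _.
have [<-|/a0->] := eqVneq (deg i) x; last by rewrite scale0r rpred0.
by rewrite rpredZ.
Qed.

(** Universal property of a direct sum of simples: a morphism out of it is a free choice of one
    vector of degree [deg i] for each [i]. *)
Definition sums_hom : grHom (gsums k deg) U := mkHom sums_lift_subproof.

Lemma sums_homE i : vsval sums_hom (dl k i) = F i.
Proof. by rewrite lfunE /= sums_lift_dl. Qed.

End Extension.

Section FromUnit.
Variables (U : grVect k gT) (v : U).

Definition scale_vec (a : k^o) : U := a *: v.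

Lemma scale_vec_linear : linear scale_vec.
Proof. by move=> c a b; rewrite /scale_vec scalerDl scalerA. Qed.

HB.instance Definition _ :=
  GRing.isLinear.Build k k^o U _ scale_vec scale_vec_linear.

Hypothesis v1 : v \in gcomp U 1%g.

Lemma gone_hom_subproof x a :
  a \in gcomp (gone k gT) x ->
  (linfun scale_vec : 'Hom(gone k gT, U)) a \in gcomp U x.
Proof.
rewrite lfunE /= /scale_vec => a0.
have [->|x1] := eqVneq x 1%g; first by rewrite rpredZ.
by rewrite (simple_comp_neq a0 x1) scale0r rpred0.
Qed.

(** As the unit object is delta_e, morphisms out of it correspond to vectors of degree e. *)
Definition gone_hom : grHom (gone k gT) U := mkHom gone_hom_subproof.

Lemma gone_homE (a : k^o) : vsval gone_hom a = a *: v.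
Proof. by rewrite lfunE. Qed.

End FromUnit.

Lemma gone_hom_eq (U : grVect k gT) (f f' : grHom (gone k gT) U) :
  vsval f (1 : k^o) = vsval f' (1 : k^o) -> f = f'.
Proof.
move=> ff'; apply: grHom_eq => a.
have -> : a = (a : k) *: (1 : k^o) by rewrite /GRing.scale /= mulr1.
by rewrite !grHomZ ff'.
Qed.

End HomsFromSums.

Section TwistedFrobenius.
Variables (k : fieldType) (gT : finGroupType) (L : {group gT}).
Variables (w : gT -> gT -> gT -> k) (hw : normalized_cocycle3 w).
Variable psi : subg_of L -> subg_of L -> k.
Hypotheses (psi_nz : nz_cochain2 psi) (psi_norm : normalized2 psi).
Hypothesis dpsi : cobounds psi w.

Local Notation A := (twalg k L).
Local Notation n := (#|L|%:R : k).
Local Notation m := (twmul psi).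
Local Notation dl := (dl k).

Hypothesis n0 : n != 0.

Let dlA (f : subg_of L) : dl f \in gcomp A (sgval f) := dl_in k _ f.

Let w0 x y z : w x y z != 0. Proof. by case: hw. Qed.

Let w1 x y : [/\ w 1%g x y = 1, w x 1%g y = 1 & w x y 1%g = 1].
Proof. by case: hw. Qed.

(** * Unit, comultiplication and counit *)

Definition twunit : grHom (gone k gT) A :=
  gone_hom (dlA 1%g : dl 1%g \in gcomp A 1%g).

Lemma twunitE : vsval twunit (1 : k^o) = dl 1%g.
Proof. by rewrite gone_homE scale1r. Qed.

(** The first factor alone indexes the factorizations of [f], so later changes of variable are
    translations of the group. *)
Definition twcomul_dl (f : subg_of L) : gtens A A :=
  n^-1 *: \sum_(g : subg_of L)
    (psi g (g^-1 * f)%g)^-1 *: pt (dl g : A) (dl (g^-1 * f)%g : A).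

Lemma twcomul_dl_in f : twcomul_dl f \in gcomp (gtens A A) (sgval f).
Proof.
apply: rpredZ; apply: rpred_sum => g _; apply: rpredZ.
rewrite -[in sgval f](mulKVg g f).
exact: (memv_pt (dlA g) (dlA (g^-1 * f)%g)).
Qed.

Definition twcomul : grHom A (gtens A A) := sums_hom twcomul_dl_in.

Lemma twcomulE f : vsval twcomul (dl f) = twcomul_dl f.
Proof. exact: sums_homE. Qed.

Definition twcounit_dl (f : subg_of L) : gone k gT :=
  if f == 1%g then n else 0.

Lemma twcounit_dl_in f : twcounit_dl f \in gcomp (gone k gT) (sgval f).
Proof.
rewrite /twcounit_dl; case: eqP => [->|_]; last exact: rpred0.
by rewrite /= /simple_comp eqxx memvf.
Qed.

Definition twcounit : grHom A (gone k gT) := sums_hom twcounit_dl_in.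

Lemma twcounitE f : vsval twcounit (dl f) = if f == 1%g then n else 0.
Proof. exact: sums_homE. Qed.

Let grHom_sum (V W : grVect k gT) (h : grHom V W) (I : finType) (c : I -> k)
    (v : I -> V) :
  vsval h (\sum_i c i *: v i) = \sum_i c i *: vsval h (v i).
Proof. exact/linear_sum_fun/lin_hom. Qed.

Let pt_suml (V W : vectType k) (I : finType) (c : I -> k) (v : I -> V) (x : W) :
  pt (\sum_i c i *: v i) x = \sum_i c i *: pt (v i) x.
Proof. exact: (linear_sum_fun ((pt_bilin V W).1 x)). Qed.

Let pt_sumr (V W : vectType k) (I : finType) (c : I -> k) (v : I -> W) (x : V) :
  pt x (\sum_i c i *: v i) = \sum_i c i *: pt x (v i).
Proof. exact: (linear_sum_fun ((pt_bilin V W).2 x)). Qed.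

(** * Algebra axioms *)

(** This is d psi = w at (f, g, h); the associator supplies the inverse of w. *)
Lemma twmulA :
  grcomp m (gtensm m (grid A)) =
  grcomp (grcomp m (gtensm (grid A) m)) (gassoc w A A A).
Proof.
apply: gsums3_hom_eq => f g h.
rewrite !grcompE gtensmE gridE twmul_dl ptZl grHomZ twmul_dl.
rewrite (gassocE w (dlA f) (dlA g) (dlA h)) !grHomZ gtensmE gridE twmul_dl.
rewrite ptZr grHomZ twmul_dl !scalerA mulgA; congr (_ *: _).
by rewrite -mulrA [psi g h * _]mulrC dpsi -!mulrA mulKf // mulrC.
Qed.

Lemma twmul1l : grcomp m (gtensm twunit (grid A)) = glunit w A.
Proof.
apply: gone_gsums_hom_eq => a f; rewrite grcompE gtensmE gridE.
rewrite gone_homE (glunitE w (dlA f)) ptZl grHomZ twmul_dl mul1g.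
by have [-> _] := psi_norm f; have [-> _ _] := w1 1%g (sgval f);
  rewrite divr1 scale1r.
Qed.

Lemma twmul1r : grcomp m (gtensm (grid A) twunit) = grunit w A.
Proof.
apply: gsums_gone_hom_eq => a f; rewrite grcompE gtensmE gridE.
rewrite gone_homE (grunitE w (dlA f)) ptZr grHomZ twmul_dl mulg1.
by have [_ ->] := psi_norm f; have [_ _ ->] := w1 (sgval f) 1%g;
  rewrite mulr1 scale1r.
Qed.

(** * Coalgebra axioms *)

(** Both sides are sums over triples with a b c = f, and their coefficients agree by the inverse of
    d psi = w at (a, b, c). *)
Lemma twcomulA :
  grcomp (grcomp (gassoc w A A A) (gtensm twcomul (grid A))) twcomul =
  grcomp (gtensm (grid A) twcomul) twcomul.
Proof.
apply: gsums_hom_eq => f; rewrite !grcompE twcomulE /twcomul_dl !grHomZ.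
congr (_ *: _); rewrite !grHom_sum.
under eq_bigr => p _ do rewrite gtensmE gridE twcomulE /twcomul_dl ptZl
  pt_suml grHomZ grHom_sum scalerA mulrC -scalerA scaler_sumr.
under [RHS]eq_bigr => p _ do rewrite gtensmE gridE twcomulE /twcomul_dl ptZr
  pt_sumr scalerA mulrC -scalerA scaler_sumr.
(* On the left the outer index is the product p = a b of the first two factors; exchanging the sums
   and substituting p = a b matches the right side. *)
rewrite -!scaler_sumr exchange_big; congr (_ *: _); apply: eq_bigr => a _ /=.
rewrite (reindex_inj (mulgI a)); apply: eq_bigr => b _ /=.
rewrite mulKg (gassocE w (dlA a) (dlA b) (dlA _)) !scalerA invMg !mulgA.
rewrite -mulgA; set c := (b^-1 * _)%g; congr (_ *: _).
have bc : (b * c = a^-1 * f)%g by rewrite /c mulKVg.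
rewrite -!invfM -bc [X in _ = X^-1]dpsi mulrC mulrA mulrAC.
by rewrite -!mulrA; congr (_ * _)^-1; rewrite mulrC.
Qed.

(** Only the factorization f = e f survives the counit, whose factor |L| cancels the averaging
    factor. *)
Lemma twcounitl :
  grcomp (grcomp (glunit w A) (gtensm twcounit (grid A))) twcomul = grid A.
Proof.
apply: gsums_hom_eq => f; rewrite !grcompE gridE twcomulE /twcomul_dl !grHomZ.
rewrite !grHom_sum (bigD1 1%g) // big1 => [|g /negPf g1].
  rewrite Monoid.mulm1 gtensmE gridE twcounitE eqxx invg1 mul1g (glunitE w (dlA f)).
  have [-> _] := psi_norm f; have [-> _ _] := w1 1%g (sgval f).
  by rewrite !scalerA divr1 invr1 mulr1 mulVf ?scale1r.
by rewrite gtensmE twcounitE g1 pt0l linear0 scaler0.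
Qed.

Lemma twcounitr :
  grcomp (grcomp (grunit w A) (gtensm (grid A) twcounit)) twcomul = grid A.
Proof.
apply: gsums_hom_eq => f; rewrite !grcompE gridE twcomulE /twcomul_dl !grHomZ.
rewrite !grHom_sum (bigD1 f) // big1 => [|g gf].
  rewrite Monoid.mulm1 gtensmE gridE mulVg twcounitE eqxx (grunitE w (dlA f)).
  have [_ ->] := psi_norm f; have [_ _ ->] := w1 (sgval f) 1%g.
  by rewrite !scalerA mulr1 invr1 mulr1 mulVf ?scale1r.
have /negPf g1 : (g^-1 * f != 1)%g by rewrite -eq_mulVg1.
by rewrite gtensmE twcounitE g1 pt0r linear0 scaler0.
Qed.

(** * Frobenius identities *)

Lemma twfrobeniusl :
  grcomp (grcomp (gtensm m (grid A)) (gassocV w A A A))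
    (gtensm (grid A) twcomul) = grcomp twcomul m.
Proof.
apply: gsums2_hom_eq => x y.
rewrite !grcompE gtensmE gridE twmul_dl grHomZ !twcomulE /twcomul_dl.
rewrite ptZr !grHomZ scalerA mulrC -scalerA; congr (_ *: _).
(* The left side has first factor x g, so the factorizations of x y are translated by x to match. *)
rewrite pt_sumr !grHom_sum scaler_sumr [RHS](reindex_inj (mulgI x)).
apply: eq_bigr => g _.
rewrite (gassocVE w (dlA x) (dlA g) (dlA _)) grHomZ gtensmE gridE twmul_dl.
rewrite ptZl !scalerA invMg -!mulgA mulKg; set h := (g^-1 * y)%g.
(* With y = g h, the coefficients agree by d psi = w at (x, g, h). *)
have -> : y = (g * h)%g by rewrite /h mulKVg.
congr (_ *: _); apply: (canRL (mulfK _)); first by rewrite psi_nz.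
rewrite -!mulrA; apply: (canLR (mulKf _)); first by rewrite psi_nz.
by rewrite [RHS]mulrC dpsi mulrA mulrAC.
Qed.

Lemma twfrobeniusr :
  grcomp (grcomp (gtensm (grid A) m) (gassoc w A A A))
    (gtensm twcomul (grid A)) = grcomp twcomul m.
Proof.
apply: gsums2_hom_eq => x y.
rewrite !grcompE gtensmE gridE twmul_dl grHomZ !twcomulE /twcomul_dl.
rewrite ptZl !grHomZ scalerA mulrC -scalerA; congr (_ *: _).
rewrite pt_suml !grHom_sum scaler_sumr; apply: eq_bigr => g _.
rewrite (gassocE w (dlA g) (dlA _) (dlA y)) grHomZ gtensmE gridE twmul_dl.
rewrite ptZr !scalerA -!mulgA mulgA; set h := (g^-1 * x)%g.
(* Here x is the factor that splits, and the relation is used at (g, h, y). *)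
have -> : x = (g * h)%g by rewrite /h mulKVg.
congr (_ *: _); apply: (canRL (mulfK _)); first by rewrite psi_nz.
rewrite -!mulrA; apply: (canLR (mulKf _)); first by rewrite psi_nz.
apply: (canLR (mulKf _)); first by rewrite w0.
by rewrite mulrC dpsi mulrA mulrAC.
Qed.

(** * Specialness and connectedness *)

Lemma twmul_comul : grcomp m twcomul = grid A.
Proof.
apply: gsums_hom_eq => f; rewrite grcompE gridE twcomulE /twcomul_dl grHomZ.
rewrite grHom_sum (eq_bigr (fun=> dl f)) => [|g _]; last first.
  by rewrite twmul_dl mulKVg scalerA mulVf ?scale1r.
rewrite sumr_const -scaler_nat scalerA.
by rewrite (card_sub (subg_of L)) mulVf ?scale1r.
Qed.

Lemma twcounit_unit : grcomp twcounit twunit = n *: grid (gone k gT).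
Proof.
apply: gone_hom_eq; rewrite grcompE twunitE twcounitE eqxx.
by rewrite /= scale_lfunE id_lfunE /GRing.scale /= mulr1.
Qed.

(** A morphism from the unit sends 1 to degree e, where only delta_e lives, so it is a multiple of
    [twunit]. *)
Lemma twconnected : \dim {: grHom (gone k gT) A} = 1%N.
Proof.
have -> : {: grHom (gone k gT) A}%VS = <[twunit]>%VS.
  apply/esym/eqP; rewrite eqEsubv subvf; apply/subvP => f _; apply/vlineP.
  exists (vsval f (1 : k^o) 1%g : k); apply: gone_hom_eq.
  have /sums_compP f0 := grHomP f (gsimple1_in k gT).
  rewrite /= scale_lfunE twunitE [LHS]ffun_dl (bigD1 1%g) //= big1 ?addr0 //.
  by move=> g g1; rewrite f0 ?scale0r.
(* [twunit] is nonzero, its value at 1 having coefficient 1 at delta_e. *)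
rewrite dim_vline; case: eqP => // u0.
have /ffunP/(_ 1%g)/eqP := twunitE.
by rewrite u0 zero_lfunE !ffunE eqxx eq_sym oner_eq0.
Qed.

End TwistedFrobenius.

Theorem proposition1p3 (k : closedFieldType) (char0 : [pchar k] =i pred0)
    (gT : finGroupType)
    (w : gT -> gT -> gT -> k) (hw : normalized_cocycle3 w)
    (L : {group gT}) (wL : trivial_class_on L w)
    (psi : subg_of L -> subg_of L -> k)
    (psi_nz : nz_cochain2 psi) (psi_norm : normalized2 psi)
    (dpsi : cobounds psi w) :
  exists (u : mhom mone (TwAlg L hw)) (D : mhom (TwAlg L hw) (TwAlg L hw \ox TwAlg L hw))
         (e : mhom (TwAlg L hw) mone),
    [/\ is_frobenius (TwMul psi hw) u D e,
        is_special (TwMul psi hw) u D e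
      & is_connected (TwAlg L hw)].
Proof.
have n0 : #|L|%:R != 0 :> k.
  by have/pcharf0P-> := char0; rewrite -lt0n cardG_gt0.
exists (twunit k L), (twcomul psi), (twcounit k L); split.
- split; [split|split| |].
  + exact: (twmulA hw dpsi).
  + exact: (twmul1l hw psi_norm).
  + exact: (twmul1r hw psi_norm).
  + exact: (twcomulA dpsi).
  + exact: (twcounitl hw psi_norm n0).
  + exact: (twcounitr hw psi_norm n0).
  + exact: (twfrobeniusl psi_nz dpsi).
  + exact: (twfrobeniusr hw psi_nz dpsi).
- split; first exact: (twmul_comul psi_nz n0).
  by exists #|L|%:R => //; exact: twcounit_unit.
- exact: twconnected.
Qed.
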